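(* There exists a Hausdorff quasitopological group $G$ (which is thus a $2$-semitopological group) such that $G$ is not a $3$-semitopological group.
   Context: A semitopological group is a group $G$ with a topology such that the multiplication $G\times G\to G$ is separately continuous. A quasitopological group is a semitopological group in which the inversion $x\mapsto x^{-1}$ is continuous. For $n\in\mathbb{N}$ (positive integers), a semitopological group $G$ with neutral element $e$ is called an $n$-semitopological group if for every $g\in G$ with $e\notin\overline{\{g\}}$ there is a neighborhood $W$ of $e$ such that $g\notin W^{n}$, where $W^n=\{w_1\cdots w_n: w_i\in W\}$. *)

(* Defs.v *)
From HB Require Import structures.
From mathcomp Require Import all_boot.
From mathcomp Require Import boolp classical_sets topology.

Set Implicit Arguments.
Unset Strict Implicit.
Unset Printing Implicit Defensive.

Local Open Scope classical_set_scope.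
Local Open Scope group_scope.

(* A group carrying a topology, with no compatibility between the two. *)
#[short(type="preTopologicalGroupType")]
HB.structure Definition PreTopologicalGroup :=
  {G of Topological G & Group G}.

HB.mixin Record PreTopologicalGroup_isSemitopological G
    & PreTopologicalGroup G := {
  mulgl_continuous : forall g : G, continuous (fun x : G => g * x) ;
  mulgr_continuous : forall g : G, continuous (fun x : G => x * g)
}.

#[short(type="semitopologicalGroupType")]
HB.structure Definition SemitopologicalGroup :=
  {G of PreTopologicalGroup G & PreTopologicalGroup_isSemitopological G}.

HB.mixin Record SemitopologicalGroup_isQuasitopological G
    & SemitopologicalGroup G := {
  invg_continuous : continuous (fun x : G => x^-1)
}.

#[short(type="quasitopologicalGroupType")]
HB.structure Definition QuasitopologicalGroup :=
  {G of SemitopologicalGroup G & SemitopologicalGroup_isQuasitopological G}.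

(* W^n = {w_1 ... w_n : w_i in W}; the product is taken in increasing order of
   the index, and the factors need not be distinct. *)
Definition set_power (G : groupType) (W : set G) (n : nat) : set G :=
  [set \prod_(i < n) w i | w in [set w : 'I_n -> G | forall i, W (w i)]].

(* Only meaningful for n > 0. *)
Definition n_semitopological (n : nat) (G : semitopologicalGroupType) : Prop :=
  forall g : G, ~ closure [set g] 1 ->
    exists2 W : set G, nbhs 1 W & ~ set_power W n g.

(* Main.v *)
Require Import Defs.
From HB Require Import structures.
From mathcomp Require Import all_boot.
From mathcomp Require Import boolp classical_sets topology.

(** In the Klein four-group the three nonzero elements add up to 0, while two
    elements add up to 0 only when they are equal.  Put a copy of it at every
    index n and add one more Boolean coordinate, so that the three nonzero
    spikes at n add up to the vector [defect] that is supported on that last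
    coordinate alone.  Take the finest topology on this Boolean group in which
    translations are continuous and spikes converge to the identity as n grows.
    Every neighborhood of 1 contains all spikes at some index n, so its cube
    contains [defect].  On the other hand, the products of spikes at pairwise
    distinct indices >= m form an open set, and a product of two such elements
    uses every index at most twice: it is 1 if its Klein coordinates vanish. *)

Set Implicit Arguments.
Unset Strict Implicit.
Unset Printing Implicit Defensive.

Local Open Scope classical_set_scope.
Local Open Scope group_scope.

Lemma set_power2P (G : groupType) (W : set G) (g : G) :
  set_power W 2 g -> exists x y, [/\ W x, W y & g = x * y].
Proof.
case=> w Ww <-; exists (w ord0), (w (lift ord0 ord0)); split; [exact: Ww..|].
by rewrite !big_ord_recl big_ord0 mulg1.
Qed.

Lemma set_power3 (G : groupType) (W : set G) (x y z : G) :
  W x -> W y -> W z -> set_power W 3 (x * y * z).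
Proof.
move=> Wx Wy Wz; exists (fun i : 'I_3 => nth 1 [:: x; y; z] i).
  by case=> [[|[|[|]]]].
by rewrite !big_ord_recl big_ord0 /= mulg1 mulgA.
Qed.

(** If the translates of [W] to [p] and [q] share a point [z], then [p^-1 * q] is the quotient of
    [p^-1 * z] by [q^-1 * z], both in [W]. *)
Lemma semitopological_hausdorff (G : semitopologicalGroupType) :
  (forall h : G, h <> 1 ->
    exists2 W : set G, nbhs 1 W & forall x y, W x -> W y -> x * y^-1 <> h) ->
  hausdorff_space G.
Proof.
move=> sep p q pq; apply: contrapT => npq.
have [|W W1 Wn] := sep (p^-1 * q).
  by move=> e; apply: npq; rewrite -[q](mulVKg p) e mulg1.
have nW r : nbhs r [set z | W (r^-1 * z)].
  by apply: (mulgl_continuous r^-1 r); rewrite mulVg.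
have [z [/= Wpz Wqz]] := pq _ _ (nW p) (nW q).
by apply: (Wn _ _ Wpz Wqz); rewrite invgM invgK mulgA mulgK.
Qed.

Lemma hausdorff_2_semitopological (G : quasitopologicalGroupType) :
  hausdorff_space G -> n_semitopological 2 G.
Proof.
move=> hG g g1; apply: contrapT => noW; apply: g1.
suff <- : 1 = g by exact: subset_closure.
apply: hG => U V U1 Vg; apply: contrapT => UV; apply: noW.
(* If [g = x * y] with both factors in this set, then [y = x^-1 * g] lies in [U] and in [V]. *)
exists (U `&` [set w | V (w^-1 * g)]).
  apply: filterI => //.
  have c : {for 1, continuous (fun w : G => w^-1 * g)}.
    apply: (@continuous_comp _ _ _ (fun w : G => w^-1) (fun w => w * g)).
      exact: invg_continuous.
    exact: mulgr_continuous.
  by apply: c; rewrite invg1 mul1g.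
move=> /set_power2P [x [y [[_ /= Vx] [Uy _] e]]]; apply: UV; exists y; split=> //.
by move: Vx; rewrite e mulKg.
Qed.

Definition klein_add (a b : bool * bool) := (a.1 (+) b.1, a.2 (+) b.2).

Lemma klein_addA : associative klein_add.
Proof. by move=> [[] []] [[] []] [[] []]. Qed.

Lemma klein_addC : commutative klein_add.
Proof. by move=> [[] []] [[] []]. Qed.

Lemma klein_add0 : left_id (false, false) klein_add.
Proof. by move=> [[] []]. Qed.

Lemma klein_addK : self_inverse (false, false) klein_add.
Proof. by move=> [[] []]. Qed.

Lemma klein_add_eq0 a b : klein_add a b = (false, false) -> a = b.
Proof. by case: a b => [[] []] [[] []]. Qed.

Definition spike_group : Type := ((nat -> bool * bool) * bool)%type.

HB.instance Definition _ := gen_eqMixin spike_group.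
HB.instance Definition _ := gen_choiceMixin spike_group.

Definition spike_one : spike_group := (fun=> (false, false), false).
Definition spike_mul (x y : spike_group) : spike_group :=
  (fun i => klein_add (x.1 i) (y.1 i), x.2 (+) y.2).

Lemma spike_mulA : associative spike_mul.
Proof.
move=> x y z; congr pair; last by rewrite /= addbA.
by apply/funext => i; rewrite /= klein_addA.
Qed.

Lemma spike_mulC : commutative spike_mul.
Proof.
move=> x y; congr pair; last by rewrite addbC.
by apply/funext => i; rewrite klein_addC.
Qed.

Lemma spike_mul1 : left_id spike_one spike_mul.
Proof.
move=> [u b]; congr pair.
by apply/funext => i; rewrite klein_add0.
Qed.

Lemma spike_mul1r : right_id spike_one spike_mul.
Proof. by move=> x; rewrite spike_mulC spike_mul1. Qed.

Lemma spike_mulK : self_inverse spike_one spike_mul.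
Proof.
move=> [u b]; congr pair; last by rewrite addbb.
by apply/funext => i; rewrite klein_addK.
Qed.

HB.instance Definition _ := @isGroup.Build spike_group spike_one id spike_mul
  spike_mulA spike_mul1 spike_mul1r spike_mulK spike_mulK.

(** The last coordinate is a non-additive function of [k]: of the three nonzero spikes at [n] only
    one carries [true], so it survives in their product. *)
Definition spike (n : nat) (k : bool * bool) : spike_group :=
  (fun i => if i == n then k else (false, false), k.1 && k.2).

Definition spike_open (U : set spike_group) : Prop :=
  forall x, U x -> exists m, forall n k, (m <= n)%N -> U (x * spike n k).

Lemma spike_openT : spike_open setT.
Proof. by move=> x _; exists 0%N. Qed.

Lemma spike_openI : setI_closed spike_open.
Proof.
move=> U V oU oV x [/oU [m Um] /oV [m' Vm]].
exists (maxn m m') => n k; rewrite geq_max => /andP[mn m'n].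
by split; [exact: Um|exact: Vm].
Qed.

Lemma spike_open_bigU (I : Type) (f : I -> set spike_group) :
  (forall i, spike_open (f i)) -> spike_open (\bigcup_i f i).
Proof.
move=> of_ x [i _ /of_ [m fm]]; exists m => n k mn.
by exists i => //; exact: fm.
Qed.

HB.instance Definition _ := @isOpenTopological.Build spike_group spike_open
  spike_openT spike_openI spike_open_bigU.

Lemma spike_openE (U : set spike_group) : open U = spike_open U.
Proof. by []. Qed.

Lemma spike_mulgl_continuous (g : spike_group) :
  continuous (fun x : spike_group => g * x).
Proof.
apply/continuousP => U; rewrite !spike_openE => oU x /oU [m Um].
by exists m => n k mn; rewrite /= mulgA; exact: Um.
Qed.

Lemma spike_mulgr_continuous (g : spike_group) :
  continuous (fun x : spike_group => x * g).
Proof.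
rewrite (_ : (fun x => x * g) = (fun x => g * x)).
  exact: spike_mulgl_continuous.
by apply/funext => x; exact: spike_mulC.
Qed.

HB.instance Definition _ := @PreTopologicalGroup_isSemitopological.Build
  spike_group spike_mulgl_continuous spike_mulgr_continuous.

Lemma spike_invg_continuous : continuous (fun x : spike_group => x^-1).
(* Every element is its own inverse, so inversion is the identity map. *)
Proof. by move=> x. Qed.

HB.instance Definition _ := @SemitopologicalGroup_isQuasitopological.Build
  spike_group spike_invg_continuous.

(** The cutoff [n] is there because [u] may have infinite support; for finite support the value
    stabilizes. *)
Definition klein_form (n : nat) (u : nat -> bool * bool) : bool :=
  \big[addb/false]_(i < n) ((u i).1 && (u i).2).

(* The products of spikes at distinct indices [>= m]: the last coordinate of
   such a product is the value of [klein_form] on its Klein coordinates. *)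
Definition spike_nbhs (m : nat) : set spike_group :=
  [set x | (forall i, (i < m)%N -> x.1 i = (false, false)) /\
    exists N, forall n, (N <= n)%N ->
      x.1 n = (false, false) /\ x.2 = klein_form n x.1].

Lemma spike_nbhs1 m : spike_nbhs m 1.
Proof.
split=> //; exists 0%N => n _; split=> //.
by rewrite /klein_form big1.
Qed.

(** A spike placed beyond [m] and the support of [x] meets a zero Klein coordinate, so it changes
    [klein_form] and the last coordinate by the same bit [k.1 && k.2]. *)
Lemma spike_nbhs_open m : open (spike_nbhs m).
Proof.
rewrite spike_openE => x [xm [N xN]]; exists (maxn m N) => n k.
rewrite geq_max => /andP[mn Nn]; split.
  move=> i im; rewrite /= xm // (ltn_eqF (leq_trans im mn)).
  by rewrite klein_add0.
have xk i : (n < i)%N -> (x * spike n k).1 i = (false, false).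
  move=> ni; have [xi _] := xN i (leq_trans Nn (ltnW ni)).
  by rewrite /= xi (gtn_eqF ni).
exists n.+1 => i ni; split; first exact: xk.
have [xn x2] := xN n Nn.
(* The cutoff [n.+1] takes in the new spike; larger cutoffs add only zero terms. *)
elim: i ni => // i IH; rewrite ltnS leq_eqVlt => /predU1P[<-|ni].
  rewrite /klein_form big_ord_recr /= xn eqxx; congr addb.
  rewrite x2; apply: eq_bigr => j _.
  by rewrite (ltn_eqF (ltn_ord j)) !addbF.
by rewrite /klein_form big_ord_recr xk //= addbF; exact: IH.
Qed.

Lemma nbhs_spike_nbhs m : nbhs (1 : spike_group) (spike_nbhs m).
Proof. by apply: open_nbhs_nbhs; split; [exact: spike_nbhs_open|exact: spike_nbhs1]. Qed.

Lemma spike_nbhs_inj m (x y : spike_group) :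
  spike_nbhs m x -> spike_nbhs m y -> x.1 = y.1 -> x = y.
Proof.
move=> [_ [N xN]] [_ [M yM]] e.
have [_ x2] := xN _ (leq_maxl N M); have [_ y2] := yM _ (leq_maxr N M).
by rewrite [x]surjective_pairing [y]surjective_pairing x2 y2 e.
Qed.

Lemma spike_group_separated (h : spike_group) : h <> 1 ->
  exists2 W : set spike_group, nbhs 1 W &
    forall x y, W x -> W y -> x * y^-1 <> h.
Proof.
move=> h1; have [h0|] := pselect (forall i, h.1 i = (false, false)).
  exists (spike_nbhs 0); first exact: nbhs_spike_nbhs.
  move=> x y Wx Wy e; apply: h1; rewrite -e.
  suff -> : x = y by rewrite mulgV.
  (* [x] and [y] agree in all Klein coordinates, and these determine the last one. *)
  apply: (spike_nbhs_inj Wx Wy); apply/funext => i; apply: klein_add_eq0.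
  by rewrite -(h0 i) -e.
(* The bound [i.+1] forces coordinate [i] itself to vanish, while [h] is nonzero there. *)
move=> /existsNP[i hi]; exists (spike_nbhs i.+1); first exact: nbhs_spike_nbhs.
by move=> x y [xi _] [yi _] e; apply: hi; rewrite -e /= xi // yi.
Qed.

Definition defect : spike_group := (fun=> (false, false), true).

Lemma spike_defect n :
  spike n (true, false) * spike n (false, true) * spike n (true, true) = defect.
Proof. by congr pair; apply/funext => i /=; case: eqP. Qed.

Lemma spike_group_not_3_semitopological : ~ n_semitopological 3 spike_group.
Proof.
move=> /(_ defect) [|W W1]; last apply.
  (* Points are closed, so 1 is in the closure of [defect] only if they are equal. *)
  have hG := semitopological_hausdorff spike_group_separated.
  have /closure_id <- : closed [set defect].
    by apply: accessible_closed_set1; exact: hausdorff_accessible.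
  by move=> /(congr1 snd).
move: W1; rewrite nbhsE => -[U [oU U1] UW].
have [m Um] := oU _ U1.
have Wm k : W (spike m k) by apply: UW; rewrite -[spike m k]mul1g; exact: Um.
by rewrite -(spike_defect m); exact: set_power3.
Qed.

Theorem mainTheorem1 :
  exists G : quasitopologicalGroupType,
    [/\ hausdorff_space G, n_semitopological 2 G & ~ n_semitopological 3 G].
Proof.
have hG := semitopological_hausdorff spike_group_separated.
exists spike_group; split=> //; first exact: hausdorff_2_semitopological.
exact: spike_group_not_3_semitopological.
Qed.
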